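(* Let $r \geq 3$ be an integer and let $G$ be an $r$-connected graph of Euler genus $\gamma \geq 0$. Then $\kappa_\rho(G) \geq \frac{1}{27}(\gamma+1)^{-1/r}$. Furthermore, when $\gamma \leq 2$: if $r = 3$ then $\kappa_\rho(G) \geq \frac{21}{256}$; if $r = 4$ then $\kappa_\rho(G) \geq \frac{5}{27}$; if $r = 5$ then $\kappa_\rho(G) \geq \frac{49}{192}$; if $r = 6$ then $\kappa_\rho(G) \geq \frac{3}{10}$.
   Context: For a tree $T$, $\Lambda(T)$ denotes its set of leaves. For a connected graph $G$, $\tau_G$ is the set of spanning trees of $G$. The robust connectivity of $G$ is $\kappa_\rho(G) = \min_{\emptyset \neq R \subseteq V(G)} \max_{T \in \tau_G} \frac{|R \cap \Lambda(T)|}{|R|}$. The Euler genus of a graph is the minimum Euler genus of a surface in which it embeds (a sphere with $k$ handles has Euler genus $2k$, with $k$ cross-caps Euler genus $k$). Graphs are simple. *)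

(* Defs.v *)
From HB Require Import structures.
From mathcomp Require Import all_boot all_order all_algebra.
From mathcomp Require Import boolp reals.

Set Implicit Arguments.
Unset Strict Implicit.
Unset Printing Implicit Defensive.

Import Order.TTheory GRing.Theory Num.Theory.

Record sgraph := SGraph {
  vertex :> finType;
  adj : rel vertex;
  adj_sym : symmetric adj;
  adj_irrefl : irreflexive adj }.
Arguments adj {s} : rename.

Definition r_connected (r : nat) (G : sgraph) : Prop :=
  r < #|G| /\
  forall S : {set G}, #|S| < r ->
    forall x y : G, x \notin S -> y \notin S ->
      connect [rel u v | [&& u \notin S, v \notin S & adj u v]] x y.

Section SpanningTrees.
Variable G : sgraph.
Implicit Types (F : {set {set G}}) (K : {set G}).

Definition edges : {set {set G}} :=
  [set [set p.1; p.2] | p : G * G & adj p.1 p.2].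

(* Spanning subgraphs of G are identified with their edge sets F. *)
Definition edge_rel F : rel G := [rel x y | [set x; y] \in F].

Definition spanning_tree F : Prop :=
  [/\ F \subset edges,
      forall x y : G, connect (edge_rel F) x y &
      forall c : seq G, ucycle (edge_rel F) c -> size c < 3].

Definition spanning_trees : {set {set {set G}}} :=
  [set F | `[< spanning_tree F >]].

Definition leaves F : {set G} := [set x | #|[set f in F | x \in f]| == 1].

(* The default values 0 and 1 do not affect the extrema: every ratio lies in
   [0, 1], and for connected nonempty G both index sets are nonempty. *)
Definition robust_connectivity (R : realType) : R :=
  \big[Num.min/1%R]_(K : {set G} | K != set0)
   \big[Num.max/0%R]_(F in spanning_trees)
     (#|K :&: leaves F|%:R / #|K|%:R)%R.
End SpanningTrees.

(* A cell decomposition of a closed connected surface, orientable or not, given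
   by its flags (incident vertex-edge-face triples, as in the barycentric
   subdivision): [fl_i] moves a flag to the one that differs from it exactly in
   its cell of dimension i.  Fixed-point freeness excludes boundary.  Loops and
   multiple edges are allowed. *)
Record surface_map := SurfaceMap {
  flag :> finType;
  fl0 : flag -> flag;
  fl1 : flag -> flag;
  fl2 : flag -> flag;
  fl0K : involutive fl0;
  fl1K : involutive fl1;
  fl2K : involutive fl2;
  fl0_free : forall d, fl0 d != d;
  fl1_free : forall d, fl1 d != d;
  fl2_free : forall d, fl2 d != d;
  fl02C : forall d, fl0 (fl2 d) = fl2 (fl0 d);
  fl02_free : forall d, fl0 (fl2 d) != d;
  map_conn :
    n_comp [rel d d' | [|| fl0 d == d', fl1 d == d' | fl2 d == d']] flag = 1 }.

Section SurfaceMaps.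
Variable M : surface_map.

(* The i-cells are the orbits of the two involutions other than [fl_i]. *)
Definition vertex_rel : rel M := [rel d d' | (fl1 d == d') || (fl2 d == d')].
Definition edge_cell_rel : rel M := [rel d d' | (fl0 d == d') || (fl2 d == d')].
Definition face_rel : rel M := [rel d d' | (fl0 d == d') || (fl1 d == d')].

Definition same_vertex : rel M := connect vertex_rel.

Definition euler_char : int :=
  ((n_comp vertex_rel M)%:Z - (n_comp edge_cell_rel M)%:Z
   + (n_comp face_rel M)%:Z)%R.

Definition orientable : Prop :=
  exists c : M -> bool, forall d : M,
    [/\ c (fl0 d) = ~~ c d, c (fl1 d) = ~~ c d & c (fl2 d) = ~~ c d].
End SurfaceMaps.

(* The sphere is [Handles 0]; [Crosscaps k] is a surface only for k > 0. *)
Inductive surface := Handles of nat | Crosscaps of nat.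

Definition surface_euler_genus (S : surface) : nat :=
  match S with Handles k => k.*2 | Crosscaps k => k end.

(* [M] decomposes a surface homeomorphic to [S], by the classification of closed
   surfaces; [cellulates M (Crosscaps 0)] never holds. *)
Definition cellulates (M : surface_map) (S : surface) : Prop :=
  match S with
  | Handles k => orientable M /\ euler_char M = (2 - (k.*2)%:Z)%R
  | Crosscaps k => ~ orientable M /\ euler_char M = (2 - k%:Z)%R
  end.

(* G is a subgraph of the 1-skeleton of M; [f x] is a flag at the image of the
   vertex x. *)
Definition in_skeleton (G : sgraph) (M : surface_map) : Prop :=
  exists f : G -> M,
    (forall x y, same_vertex (f x) (f y) -> x = y) /\
    (forall x y, adj x y ->
       exists d, same_vertex (f x) d /\ same_vertex (f y) (fl0 d)).

(* An embedding in S, cellular or not, is the same as being drawn in the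
   1-skeleton of some cell decomposition of S. *)
Definition embeds (G : sgraph) (S : surface) : Prop :=
  exists M : surface_map, cellulates M S /\ in_skeleton G M.

Definition has_euler_genus (G : sgraph) (g : nat) : Prop :=
  (exists S, embeds G S /\ surface_euler_genus S = g) /\
  (forall S, embeds G S -> g <= surface_euler_genus S).

(* Main.v *)
Require Import Defs.
From mathcomp Require Import all_boot all_order all_algebra.
From mathcomp Require Import boolp reals exp.
From mathcomp Require Import zify ring lra.
Import Order.TTheory GRing.Theory Num.Theory.

Set Implicit Arguments.
Unset Strict Implicit.
Unset Printing Implicit Defensive.

(** A set of vertices [X] consists of leaves of some spanning tree as soon as
    [G - X] is connected and every vertex of [X] has a neighbour outside [X].
    The edges of a suitable cut connect [G], so one of its two sides contains a
    set [A] of at least half of the vertices of the given set [K] such that [G]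
    stays connected when the edges inside [A] are deleted; this property passes
    to the subsets of [A].

    While [G - A] is disconnected, put back into the graph a vertex of [A] that
    is adjacent to as many components as possible.  With [z] vertices in [A] and
    [k] components, each of which has at least [r] neighbours in [A], there is a
    vertex that sees [d >= max(2, r k / z)] components, and the step leads to
    [z - 1] vertices and at most [k - d + 1] components.  A piecewise linear
    potential is nondecreasing along these steps and bounds from below the final
    size of [A].

    The initial value of [k] is bounded by Euler's formula for the bipartite
    minor on [A] and the components of [G - A]: [r k <= 2 (z + k) + 2 g - 4].
    For maps given by flags, Euler's inequality for a subgraph follows by adding
    edges one at a time, since an edge that joins two components of the subgraph
    has the same region on both sides, by a parity argument. *)

(** * Components of relations *)

Lemma connect_sub_in (T : finType) (e e' : rel T) (P : {pred T}) :
  closed e P -> {in P, forall x, subpred (e x) (e' x)} ->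
  {in P, forall x, subpred (connect e x) (connect e' x)}.
Proof.
move=> clP sub x + _ /connectP[p + ->].
elim: p x => [|y p IHp] x xP /=; first by rewrite connect0.
case/andP=> exy /IHp/=; rewrite -(clP _ _ exy) => /(_ xP).
exact/connect_trans/connect1/sub.
Qed.

Lemma sub_closed (T : finType) (e e' : rel T) (P : {pred T}) :
  subrel e e' -> closed e' P -> closed e P.
Proof. by move=> sub clP x y /sub/clP. Qed.

Lemma eq_n_comp_in (T : finType) (e e' : rel T) (P : {pred T}) :
  closed e P -> closed e' P -> {in P, forall x, e x =1 e' x} ->
  n_comp e P = n_comp e' P.
Proof.
move=> cl cl' eqP; apply: eq_card => x; rewrite !inE.
case xP: (x \in P); rewrite ?andbF // /roots /fingraph.root.
rewrite (@eq_pick _ _ (connect e' x)) // => y; apply/idP/idP.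
  by apply: (connect_sub_in cl) xP y => z zP w; rewrite eqP.
by apply: (connect_sub_in cl') xP y => z zP w; rewrite eqP.
Qed.

Definition component (T : finType) (e : rel T) (x : T) : {set T} :=
  [set y | connect e x y].

Section SymmetricComponents.
Variables (T : finType) (e : rel T).
Hypothesis sym_e : connect_sym e.
Implicit Types (P : {pred T}) (B : {set T}).

Lemma leq_n_comp_label (U : finType) P (S : {set U}) (lab : T -> U) :
  {in P, forall x, lab x \in S} ->
  {in P &, forall x y, lab x = lab y -> connect e x y} ->
  n_comp e P <= #|S|.
Proof.
move=> labS labP; rewrite /n_comp_mem -(@card_in_image _ _ lab).
  apply/subset_leq_card/subsetP=> u /imageP[x] /[!inE] /andP[_ xP] ->.
  exact: labS.
move=> x y /[!inE] /andP[/eqP rx xP] /andP[/eqP ry yP] /(labP _ _ xP yP).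
by move/(fingraph.rootP sym_e); rewrite rx ry.
Qed.

Lemma mem_root P x : closed e P -> (fingraph.root e x \in P) = (x \in P).
Proof. by move=> clP; rewrite -(closed_connect clP (connect_root e x)). Qed.

Lemma n_comp_gt0 P x : closed e P -> x \in P -> 0 < n_comp e P.
Proof.
move=> clP xP; apply/card_gt0P; exists (fingraph.root e x).
by rewrite !inE roots_root //= mem_root.
Qed.

Lemma n_comp_le1P P : closed e P ->
  reflect {in P &, forall x y, connect e x y} (n_comp e P <= 1).
Proof.
move=> clP; apply: (iffP card_le1_eqP) => [eq_root x y xP yP | conn x y].
  by apply/(fingraph.rootP sym_e)/eq_root; rewrite !inE roots_root //= mem_root.
move=> /andP[/eqP rx xP] /andP[/eqP ry yP]; rewrite -rx -ry.
exact/(fingraph.rootP sym_e)/conn.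
Qed.

Lemma n_compT_le1P : reflect (forall x y, connect e x y) (n_comp e T <= 1).
Proof. by apply: (iffP (n_comp_le1P _)) => // conn x y *; apply: conn. Qed.

Lemma component_closed x : closed e (component e x).
Proof. by move=> y z yz; rewrite !inE; apply: (connect_closed sym_e x yz). Qed.

Lemma sum_card_components B :
  \sum_(r | roots e r) #|B :&: component e r| = #|B|.
Proof.
rewrite -sum1_card [RHS](partition_big (fingraph.root e) (roots e)) /=; last first.
  by move=> x _; apply: roots_root.
apply: eq_bigr => r /eqP root_r; rewrite sum1dep_card; apply: eq_card => x.
by rewrite !inE -(fingraph.root_connect sym_e) root_r eq_sym.
Qed.

Lemma sum_roots_const k : \sum_(r | roots e r) k = n_comp e T * k.
Proof. by rewrite sum_nat_const; congr (_ * _); apply: eq_card => x; rewrite !inE andbT. Qed.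

End SymmetricComponents.

Section AddLink.
Variables (T : finType) (e e' : rel T) (x y : T).
Hypotheses (sym_e : connect_sym e) (sym_e' : connect_sym e').
Hypothesis sub_ee' : subrel e e'.
Hypothesis link_e' : forall u v, e' u v ->
  [\/ e u v, connect e x u /\ connect e y v | connect e y u /\ connect e x v].

Lemma connect_link u v : connect e' u v -> connect e x y || ~~ connect e y u ->
  connect e u v || connect e u x && connect e y v.
Proof.
move=> uv off_link.
pose D := [pred w | connect e u w || connect e u x && connect e y w].
suff clD : closed e' D by have := closed_connect clD uv; rewrite !inE connect0.
apply: (intro_closed sym_e') => {uv v} a b /link_e'[ab|[xa yb]|[ya xb]].
- by rewrite !inE !(same_connect1r sym_e ab).
- rewrite !inE yb andbT => /orP[ua|/andP[-> _]]; last by rewrite orbT.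
  have ux : connect e u x by rewrite (connect_trans ua) // sym_e.
  by rewrite ux orbT.
- rewrite !inE => /orP[ua|/andP[ux _]]; last by rewrite (connect_trans ux xb).
  have yu : connect e y u by rewrite (connect_trans ya) // sym_e.
  rewrite yu orbF in off_link.
  by rewrite (connect_trans _ xb) // sym_e (connect_trans off_link).
Qed.

Lemma connect_link_id : connect e x y -> connect e =2 connect e'.
Proof.
move=> xy u v; apply/idP/idP.
  by apply: connect_sub => a b /sub_ee'; apply: connect1.
move/connect_link; rewrite xy => /(_ isT)/orP[//|/andP[ux yv]].
exact: connect_trans ux (connect_trans xy yv).
Qed.

Lemma n_comp_link : n_comp e T <= n_comp e' T + ~~ connect e x y.
Proof.
have [xy|sep_xy] := boolP (connect e x y).
  by rewrite addn0 (eq_n_comp (connect_link_id xy)).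
pose lab u := if connect e y u then None else Some (fingraph.root e' u).
pose S := None |: [set Some r | r in [set r | roots e' r]].
have cardS : #|S| = n_comp e' T + 1.
  rewrite cardsU1 card_imset; last exact: Some_inj.
  rewrite (_ : None \notin _); last by apply/imsetP => -[? _].
  by rewrite addnC; congr (_ + _); apply: eq_card => r; rewrite !inE andbT.
rewrite -cardS; apply: (leq_n_comp_label sym_e (lab := lab)) => [u _ | u v _ _].
  rewrite !inE /lab; case: ifP => //= _; apply/imsetP.
  by exists (fingraph.root e' u); rewrite // inE roots_root.
rewrite /lab; case: ifPn => yu; case: ifPn => yv //.
  by move=> _; rewrite sym_e in yu; apply: connect_trans yu yv.
case=> /(fingraph.rootP sym_e')/connect_link; rewrite yu orbT (negPf yv) andbF orbF.
by apply.
Qed.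

End AddLink.

(** * Cell decompositions *)

Lemma even_card_involution (T : finType) (h : T -> T) (S : {set T}) :
  involutive h -> (forall x, h x != x) -> {in S, forall x, h x \in S} ->
  ~~ odd #|S|.
Proof.
move=> hK h_free hS.
have clS : fclosed h S by move=> x _ /eqP<-; apply/idP/idP => [|/hS]; rewrite ?hK // => /hS.
rewrite -(@fcard_order_set _ h (can_inj hK) 2) ?oddM ?andbF //.
apply/subsetP => x _; rewrite inE (@order_cycle _ h [:: x; h x]) //= ?inE ?eqxx //.
  by rewrite hK eqxx.
by rewrite eq_sym h_free.
Qed.

Lemma involution_eq_sym (T : eqType) (h : T -> T) :
  involutive h -> forall x y, (h x == y) = (h y == x).
Proof. by move=> hK x y; rewrite (can2_eq hK hK) eq_sym. Qed.

Lemma closed2P (T : finType) (h k : T -> T) (S : {pred T}) :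
  closed [rel x y | (h x == y) || (k x == y)] S <->
  (forall x, (h x \in S) = (x \in S)) /\ (forall x, (k x \in S) = (x \in S)).
Proof.
split=> [clS | [hS kS] x y /= /orP[]/eqP<-]; rewrite ?hS ?kS //.
by split=> x; rewrite -(clS x) //= eqxx ?orbT.
Qed.

Section Glue.
Variables (T : finType) (i j k : T -> T).
Hypotheses (iK : involutive i) (jK : involutive j) (kK : involutive k).
Hypothesis ikC : forall x, i (k x) = k (i x).
Implicit Types (H : {set T}) (d x y : T).

Definition glue_rel H x y := [|| i x == y, j x == y | (x \in H) && (k x == y)].
Arguments glue_rel H x y /.

Definition klein_orbit d : {set T} := [set d; k d; i d; k (i d)].

Lemma klein_orbit_stable d x : (k x \in klein_orbit d) = (x \in klein_orbit d).
Proof.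
rewrite !inE !(can2_eq kK kK) !kK -!orbA orbCA.
by congr [|| _, _ | _]; rewrite orbC.
Qed.

Lemma glue_rel_sym H : (forall x, (k x \in H) = (x \in H)) -> connect_sym (glue_rel H).
Proof.
move=> kH; apply: sym_connect_sym => x y /=.
rewrite (involution_eq_sym iK) (involution_eq_sym jK) (involution_eq_sym kK).
by congr [|| _, _ | _]; case: eqP => [<-|_]; rewrite ?andbF // kH.
Qed.

Section AddOrbit.
Variables (H : {set T}) (d : T).
Hypothesis kH : forall x, (k x \in H) = (x \in H).

Let H' := H :|: klein_orbit d.

Let sym_glue : connect_sym (glue_rel H). Proof. exact: glue_rel_sym. Qed.

Let sym_glue' : connect_sym (glue_rel H').
Proof. by apply: glue_rel_sym => x; rewrite [LHS]in_setU [RHS]in_setU kH klein_orbit_stable. Qed.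

Let sub_glue : subrel (glue_rel H) (glue_rel H').
Proof. by move=> x y /= /or3P[->|->|/andP[xH ->]]; rewrite ?in_setU ?xH ?orbT. Qed.

Let glue_link u v : glue_rel H' u v ->
  [\/ glue_rel H u v,
      connect (glue_rel H) d u /\ connect (glue_rel H) (k d) v |
      connect (glue_rel H) (k d) u /\ connect (glue_rel H) d v].
Proof.
have connect_i x : connect (glue_rel H) x (i x) by apply: connect1; rewrite /= eqxx.
move=> /= /or3P[iuv|juv|]; [by apply: Or31; rewrite iuv | by apply: Or31; rewrite juv orbT |].
rewrite in_setU => /andP[/orP[uH|uO] kuv]; first by apply: Or31; rewrite uH kuv !orbT.
move: uO kuv; rewrite !inE => /orP[/orP[/orP[]|]|]/eqP-> /eqP<-;
  rewrite ?kK -?ikC ?connect0 ?connect_i; [exact: Or32|exact: Or33|exact: Or32|exact: Or33].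
Qed.

Lemma connect_glue_id : connect (glue_rel H) d (k d) ->
  connect (glue_rel H) =2 connect (glue_rel H').
Proof. exact: connect_link_id sym_glue sym_glue' sub_glue glue_link. Qed.

Lemma n_comp_glue :
  n_comp (glue_rel H) T <= n_comp (glue_rel H') T + ~~ connect (glue_rel H) d (k d).
Proof. exact: n_comp_link sym_glue sym_glue' sub_glue glue_link. Qed.

End AddOrbit.
End Glue.

Arguments glue_rel {T} i j k H x y /.

#[local] Hint Resolve fl0K fl1K fl2K fl02C : core.

Section Maps.
Variable M : surface_map.
Implicit Types (H S K Z : {set M}) (d x y : M).

(* The classes are the components of the spanning subgraph whose edges are the
   edge cells in [H]. *)
Definition graph_rel H : rel M := glue_rel (@fl2 M) (@fl1 M) (@fl0 M) H.
Arguments graph_rel H /.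

(* The classes are the faces of that subgraph: the face cells are glued together
   across the edges outside [H]. *)
Definition region_rel H : rel M := glue_rel (@fl0 M) (@fl1 M) (@fl2 M) (~: H).
Arguments region_rel H /.

Definition edge_orbit d : {set M} := klein_orbit (@fl2 M) (@fl0 M) d.

Definition boundary S : {set M} := [set x in S | fl2 x \notin S].

Definition edge_set H := closed (@edge_cell_rel M) H.

Lemma edge_setP H : edge_set H <->
  (forall x, (fl0 x \in H) = (x \in H)) /\ (forall x, (fl2 x \in H) = (x \in H)).
Proof. exact: closed2P. Qed.

Lemma edge_setC H : edge_set H -> edge_set (~: H).
Proof. by move=> eH x y /eH; rewrite !in_setC => ->. Qed.

Lemma edge_setU H Z : edge_set H -> edge_set Z -> edge_set (H :|: Z).
Proof. by move=> eH eZ x y xy; rewrite [LHS]in_setU [RHS]in_setU (eH _ _ xy) (eZ _ _ xy). Qed.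

Lemma edge_cell_rel_sym : connect_sym (@edge_cell_rel M).
Proof.
apply: sym_connect_sym => x y; rewrite /edge_cell_rel /=.
by rewrite (involution_eq_sym (@fl0K M)) (involution_eq_sym (@fl2K M)).
Qed.

Lemma vertex_rel_sym : connect_sym (@vertex_rel M).
Proof.
apply: sym_connect_sym => x y; rewrite /vertex_rel /=.
by rewrite (involution_eq_sym (@fl1K M)) (involution_eq_sym (@fl2K M)).
Qed.

Lemma graph_rel_sym H : edge_set H -> connect_sym (graph_rel H).
Proof.
by case/edge_setP=> H_fl0 _; apply: glue_rel_sym.
Qed.

Lemma region_rel_sym H : edge_set H -> connect_sym (region_rel H).
Proof.
by move/edge_setC/edge_setP=> [_ H_fl2]; apply: glue_rel_sym.
Qed.

Lemma mem_edge_orbit d : d \in edge_orbit d.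
Proof. by rewrite !inE eqxx. Qed.

Lemma edge_orbitC d : edge_orbit d = klein_orbit (@fl0 M) (@fl2 M) d.
Proof. by apply/setP=> x; rewrite !inE fl02C; congr (_ || _); rewrite orbAC. Qed.

Lemma edge_set_orbit d : edge_set (edge_orbit d).
Proof.
apply/edge_setP; split=> x; first exact: klein_orbit_stable (@fl0K M) _ _.
by rewrite edge_orbitC; apply: klein_orbit_stable (@fl2K M) _ _.
Qed.

Lemma connect_edge_cell d x : connect (@edge_cell_rel M) d x = (x \in edge_orbit d).
Proof.
apply/idP/idP => [dx|].
  by rewrite -(closed_connect (@edge_set_orbit d) dx) mem_edge_orbit.
have connect_fl0 y : connect (@edge_cell_rel M) y (fl0 y).
  by apply: connect1; rewrite /edge_cell_rel /= eqxx.
have connect_fl2 y : connect (@edge_cell_rel M) y (fl2 y).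
  by apply: connect1; rewrite /edge_cell_rel /= eqxx orbT.
rewrite !inE => /orP[/orP[/orP[]|]|] /eqP-> //.
exact: connect_trans (connect_fl2 d) (connect_fl0 _).
Qed.

Lemma mem_edge_set H d x : edge_set H -> x \in edge_orbit d -> (x \in H) = (d \in H).
Proof. by move=> eH; rewrite -connect_edge_cell => /(closed_connect eH) ->. Qed.

Lemma edge_orbit_sub H d : edge_set H -> d \in H -> edge_orbit d \subset H.
Proof. by move=> eH dH; apply/subsetP=> x /(mem_edge_set eH) ->. Qed.

Lemma card_edge_orbit d : #|edge_orbit d| = 4.
Proof.
have free0 x : (x == fl0 x) = false by rewrite eq_sym; apply/negbTE/fl0_free.
have free2 x : (x == fl2 x) = false by rewrite eq_sym; apply/negbTE/fl2_free.
have free02 x : (x == fl0 (fl2 x)) = false by rewrite eq_sym; apply/negbTE/fl02_free.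
rewrite /edge_orbit /klein_orbit -!setUA !cardsU1 cards1 !inE !free0 !free2 !free02.
by rewrite (can2_eq (@fl0K M) (@fl0K M)) free02 (inj_eq (can_inj (@fl0K M))) free2.
Qed.

Lemma card_add_edge H d : edge_set H -> d \notin H ->
  #|H :|: edge_orbit d| = #|H| + 4.
Proof.
move=> eH dH; rewrite cardsU card_edge_orbit (_ : _ :&: _ = set0) ?cards0 ?subn0 //.
apply/eqP; rewrite setI_eq0 disjoint_sym disjoint_subset; apply/subsetP => x.
by move=> xO; rewrite inE (mem_edge_set eH xO).
Qed.

Lemma card_flags : #|M| = n_comp (@edge_cell_rel M) M * 4.
Proof.
rewrite -sum_roots_const -cardsT -(sum_card_components edge_cell_rel_sym).
apply: eq_bigr => r _; rewrite -(card_edge_orbit r); congr #|pred_of_set _|.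
by apply/setP=> x; rewrite in_setI in_setT inE connect_edge_cell.
Qed.

Lemma map_connected x y :
  connect [rel d d' | [|| fl0 d == d', fl1 d == d' | fl2 d == d']] x y.
Proof.
set e := (X in connect X).
have sym_e : connect_sym e.
  apply: sym_connect_sym => u v; rewrite /e /= (involution_eq_sym (@fl0K M)).
  by rewrite (involution_eq_sym (@fl1K M)) (involution_eq_sym (@fl2K M)).
have /(n_compT_le1P sym_e) : n_comp e M <= 1 by rewrite map_conn.
exact.
Qed.

(* A union of faces has an even boundary at every vertex, hence on every union of
   vertices [K]; the boundary edges with both ends in [K] are counted twice. *)
Lemma even_boundary S K Z :
  closed (@face_rel M) S -> closed (@vertex_rel M) K -> edge_set Z ->
  {in Z, forall x, fl0 x \in K = (x \in K)} ->
  ~~ odd #|(boundary S :&: K) :\: Z|.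
Proof.
move=> /closed2P[S_fl0 S_fl1] /closed2P[K_fl1 K_fl2] /edge_setP[Z_fl0 _] K_Z.
have even_SK : ~~ odd #|S :&: K|.
  by apply: even_card_involution (@fl1K M) (@fl1_free M) _ => x; rewrite !inE S_fl1 K_fl1.
have even_inner : ~~ odd #|(S :&: K) :&: [set x | fl2 x \in S]|.
  apply: even_card_involution (@fl2K M) (@fl2_free M) _ => x; rewrite !inE fl2K K_fl2.
  by case/andP=> /andP[-> ->] ->.
have even_Z : ~~ odd #|(boundary S :&: K) :&: Z|.
  apply: even_card_involution (@fl0K M) (@fl0_free M) _ => x.
  by rewrite !inE -fl02C !S_fl0 Z_fl0 => /andP[/andP[-> xK] xZ]; rewrite K_Z // xK.
have boundaryE : (S :&: K) :\: [set x | fl2 x \in S] = boundary S :&: K.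
  by apply/setP=> x; rewrite !inE andbCA andbA.
have := cardsID [set x | fl2 x \in S] (S :&: K); rewrite boundaryE.
have := cardsID Z (boundary S :&: K).
lia.
Qed.

End Maps.

Arguments graph_rel {M} H /.
Arguments region_rel {M} H /.

Section EulerInequality.
Variable M : surface_map.
Implicit Types (H : {set M}) (d x y : M).

Lemma sub_vertex_graph H : subrel (@vertex_rel M) (graph_rel H).
Proof. by move=> x y /= /orP[]->; rewrite ?orbT. Qed.

Lemma sub_face_region H : subrel (@face_rel M) (region_rel H).
Proof. by move=> x y /= /orP[]->; rewrite ?orbT. Qed.

(* Adding an edge to [H] cannot both merge two components and split a face: the
   boundary of the new face would meet a component in an odd number of ends. *)
Lemma bridge_or_same_region H d :
  edge_set H -> d \notin H ->
  connect (graph_rel H) d (fl0 d) || connect (region_rel (H :|: edge_orbit d)) d (fl2 d).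
Proof.
move=> eH dH; set H' := H :|: _.
have eH' : edge_set H' by apply: edge_setU => //; apply: edge_set_orbit.
apply: contraT; rewrite negb_or => /andP[far_graph far_region].
pose S := component (region_rel H') d; pose K := component (graph_rel H) d.
have clS : closed (region_rel H') S by apply/component_closed/region_rel_sym.
have clK : closed (graph_rel H) K by apply/component_closed/graph_rel_sym.
have clS_face := sub_closed (@sub_face_region H') clS.
have clK_vertex := sub_closed (@sub_vertex_graph H) clK.
have boundary_d : (boundary S :&: K) :\: H = [set d].
  apply/setP=> x; apply/setDP/set1P => [[/setIP[/setIdP[xS x2S] xK] xH]|->]; last first.
    by rewrite !inE far_region !connect0.
  have : x \in H'.
    by apply: contraR x2S => xH'; rewrite -(clS x) //= inE xH' eqxx !orbT.
  rewrite in_setU (negPf xH) /= !inE => /orP[/orP[/orP[]|]|] /eqP xE //; exfalso.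
  - by move: xK; rewrite xE inE (negPf far_graph).
  - by move: xS; rewrite xE inE (negPf far_region).
  - have [S_fl0 _] := (closed2P _ _ _).1 clS_face.
    by move: xS; rewrite xE S_fl0 inE (negPf far_region).
have := even_boundary clS_face clK_vertex eH; rewrite boundary_d cards1; apply=> x xH.
by rewrite -(clK x) //= xH eqxx !orbT.
Qed.

Lemma setC_add_edge H d : edge_set H -> d \notin H ->
  ~: H = ~: (H :|: edge_orbit d) :|: klein_orbit (@fl0 M) (@fl2 M) d.
Proof.
move=> eH dH; rewrite -edge_orbitC; apply/setP=> x.
rewrite [RHS]in_setU !in_setC [x \in H :|: _]in_setU negb_or.
have [xO|_] := boolP (x \in edge_orbit d); last by rewrite andbT orbF.
by rewrite (mem_edge_set eH xO) dH orbT.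
Qed.

Lemma connect_region_add_edge H d : edge_set H -> d \notin H ->
  connect (region_rel (H :|: edge_orbit d)) d (fl2 d) ->
  connect (region_rel (H :|: edge_orbit d)) =2 connect (region_rel H).
Proof.
move=> eH dH; rewrite {3}/region_rel (setC_add_edge eH dH).
have /edge_setC/edge_setP[_ C_fl2] := edge_setU eH (@edge_set_orbit _ d).
exact: connect_glue_id.
Qed.

Lemma n_comp_graph_add_edge H d : edge_set H ->
  n_comp (graph_rel H) M
    <= n_comp (graph_rel (H :|: edge_orbit d)) M + ~~ connect (graph_rel H) d (fl0 d).
Proof.
by case/edge_setP=> H_fl0 _; apply: n_comp_glue.
Qed.

Lemma n_comp_region_add_edge H d : edge_set H -> d \notin H ->
  n_comp (region_rel (H :|: edge_orbit d)) M
    <= n_comp (region_rel H) M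
       + ~~ connect (region_rel (H :|: edge_orbit d)) d (fl2 d).
Proof.
move=> eH dH; rewrite {2}/region_rel (setC_add_edge eH dH).
have /edge_setC/edge_setP[_ C_fl2] := edge_setU eH (@edge_set_orbit _ d).
exact: n_comp_glue.
Qed.

Lemma edge_set_ind H' (Q : {set M} -> Prop) :
  edge_set H' -> Q H' ->
  (forall H d, edge_set H -> d \notin H -> Q (H :|: edge_orbit d) -> Q H) ->
  forall H, edge_set H -> H \subset H' -> Q H.
Proof.
move=> eH' QH' Qadd H; have [n] := ubnP #|H' :\: H|.
elim: n H => // n IHn H; rewrite ltnS => le_n eH sHH'.
have [/eqP|[d /setDP[dH' dH]]] := set_0Vmem (H' :\: H).
  by rewrite setD_eq0 => sH'H; have -> : H = H' by apply/eqP; rewrite eqEsubset sHH'.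
have eHd := edge_setU eH (@edge_set_orbit _ d).
apply: (Qadd _ d) => //; apply: IHn => //; last by rewrite subUset sHH' edge_orbit_sub.
apply: leq_trans le_n; apply: proper_card; rewrite properE setDS ?subsetUl //=.
apply/subsetPn; exists d; first by rewrite in_setD dH.
by rewrite in_setD negb_and negbK in_setU mem_edge_orbit orbT.
Qed.

Lemma n_comp_graph_sub H H' : edge_set H -> edge_set H' -> H \subset H' ->
  n_comp (graph_rel H) M * 4 + #|H| <= n_comp (graph_rel H') M * 4 + #|H'|.
Proof.
move=> + eH'; move: H; apply: (edge_set_ind eH') => // H d eH dH.
rewrite card_add_edge //; have := n_comp_graph_add_edge d eH; lia.
Qed.

Lemma n_comp_region_graph_sub H H' : edge_set H -> edge_set H' -> H \subset H' ->
  n_comp (region_rel H') M * 4 + n_comp (graph_rel H) M * 4 + #|H|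
    <= n_comp (region_rel H) M * 4 + n_comp (graph_rel H') M * 4 + #|H'|.
Proof.
move=> + eH'; move: H; apply: (edge_set_ind eH') => // H d eH dH.
rewrite card_add_edge //; have := n_comp_graph_add_edge d eH.
have := n_comp_region_add_edge eH dH; have := bridge_or_same_region eH dH.
by do 2 case: (connect _ _ _); lia.
Qed.

Lemma edge_set0 : edge_set (set0 : {set M}).
Proof. by move=> x y _; rewrite !in_set0. Qed.

Lemma edge_setT : edge_set [set: M].
Proof. by move=> x y _; rewrite !in_setT. Qed.

Lemma region_rel0_connected x y : connect (region_rel set0) x y.
Proof.
have := map_connected x y; apply: connect_sub => u v uv.
by apply: connect1; rewrite /= in_setC in_set0.
Qed.

Lemma graph_relT_connected x y : connect (graph_rel setT) x y.
Proof.
have := map_connected x y; apply: connect_sub => u v uv.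
by apply: connect1; rewrite /= in_setT; case/or3P: uv => ->; rewrite ?orbT.
Qed.

Lemma leq_euler_subgraphs (g : nat) F H : euler_char M = (2 - g%:Z)%R ->
  edge_set F -> edge_set H ->
  n_comp (graph_rel H) M * 4 + #|H| + 4
    <= n_comp (graph_rel F) M * 4 + #|F| + n_comp (region_rel H) M * 4 + 4 * g.
Proof.
move=> chi eF eH.
have vertices : n_comp (graph_rel set0) M = n_comp (@vertex_rel M) M.
  apply: eq_n_comp; apply: eq_connect => x y.
  by rewrite /vertex_rel /= in_set0 orbF orbC.
have faces : n_comp (region_rel setT) M = n_comp (@face_rel M) M.
  by apply: eq_n_comp; apply: eq_connect => x y; rewrite /face_rel /= setCT in_set0 orbF.
have /(n_compT_le1P (graph_rel_sym edge_setT)) graph_conn := graph_relT_connected.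
have := n_comp_graph_sub edge_set0 eF (sub0set F).
have := n_comp_region_graph_sub eH edge_setT (subsetT H).
rewrite vertices faces cards0 cardsT card_flags; move: graph_conn chi.
rewrite /euler_char; lia.
Qed.

Lemma spanning_forest (I : {set M}) : edge_set I ->
  exists F : {set M}, [/\ F \subset I, edge_set F,
    forall x y, connect (region_rel F) x y &
    forall x y, connect (graph_rel I) x y -> connect (graph_rel F) x y].
Proof.
move=> eI; pose cotree (F : {set M}) :=
  `[< [/\ F \subset I, edge_set F & forall x y, connect (region_rel F) x y] >].
have cotree0 : cotree set0.
  by apply/asboolP; split; [exact: sub0set | exact: edge_set0 | exact: region_rel0_connected].
have [F /maxsetP[/asboolP[sFI eF connF] maxF] _] := maxset_exists cotree0.
exists F; split=> // x y; apply: connect_sub => {x y} x y.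
rewrite /= => /or3P[fxy|fxy|/andP[xI /eqP<-]].
- by apply: connect1; rewrite /= fxy.
- by apply: connect1; rewrite /= fxy orbT.
have [xF|xF] := boolP (x \in F); first by apply: connect1; rewrite /= xF eqxx !orbT.
have /orP[//|same] := bridge_or_same_region eF xF.
suff FE : F :|: edge_orbit x = F.
  by move: xF; rewrite -FE in_setU mem_edge_orbit orbT.
apply: maxF (subsetUl _ _); apply/asboolP; split=> [||u v].
- by rewrite subUset sFI edge_orbit_sub.
- exact: edge_setU eF (@edge_set_orbit _ x).
- by rewrite connect_region_add_edge.
Qed.

End EulerInequality.

(** * Bipartite minors of maps *)

(* Two darts at each end of a path of three edges of a simple bipartite graph give
   four darts on one side; [h] reverses the darts. *)
Lemma card_bipartite_darts (T : finType) (L : eqType) (h : T -> T) (lab : T -> L)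
    (side : L -> bool) (D : {set T}) :
  involutive h -> {in D, forall x, h x \in D} ->
  {in D, forall x, side (lab (h x)) = ~~ side (lab x)} ->
  {in D &, forall x y, lab x = lab y -> lab (h x) = lab (h y) -> x = y} ->
  {in D, forall x, exists2 y, y \in D :\ x & lab y = lab x} ->
  D != set0 -> 8 <= #|D|.
Proof.
move=> hK hD cross simple mate /set0Pn[x xD].
pose half s := [set z in D | side (lab z) == s].
have [y /setD1P[yx yD] ly] := mate x xD.
have [u /setD1P[uhx uD] lu] := mate _ (hD x xD).
have [v /setD1P[vhy vD] lv] := mate _ (hD y yD).
have lhxy : lab (h x) != lab (h y).
  by apply: contra_neq yx => lhxy; apply: simple.
have half4 : 4 <= #|half (~~ side (lab x))|.
  have uniq4 : uniq [:: h x; u; h y; v].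
    have neq_lab a b : lab a != lab b -> a != b by apply: contra_neq => ->.
    by rewrite /= !inE !negb_or (eq_sym (h x) u) uhx (eq_sym (h y) v) vhy !neq_lab ?lu ?lv.
  rewrite cardE; apply: (uniq_leq_size uniq4) => z; rewrite mem_enum !inE.
  by case/or4P=> /eqP->; rewrite ?uD ?vD ?hD //= ?lu ?lv ?cross ?ly ?eqxx.
have half_h s : #|half s| <= #|half (~~ s)|.
  rewrite -(card_imset _ (can_inj hK)); apply/subset_leq_card/subsetP=> _ /imsetP[z zs ->].
  by move: zs; rewrite !inE => /andP[zD /eqP<-]; rewrite hD ?cross /=.
have <- : #|half (~~ side (lab x))| + #|half (~~ ~~ side (lab x))| = #|D|.
  rewrite -(cardsID [set z | side (lab z) == ~~ side (lab x)] D); congr (_ + _).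
    by apply: eq_card => z; rewrite !inE.
  by apply: eq_card => z; rewrite !inE andbC; case: (side _); case: (side _).
by apply: leq_trans (leq_add half4 (leq_trans half4 (half_h _))).
Qed.

Section BipartiteMinor.
Variables (M : surface_map) (L : finType) (lab : M -> option L).
Implicit Types (B F H S : {set M}) (x y : M).

Definition inner_edges : {set M} := [set x | lab x && (lab x == lab (fl0 x))].

(* The branch sets of the minor are the sets of flags with a common label. *)
Hypothesis lab_vertex : forall x y, @vertex_rel M x y -> lab x = lab y.
Hypothesis lab_connected : forall x y, lab x -> lab x = lab y ->
  connect (graph_rel inner_edges) x y.

Variables (X Y : {set L}) (E : {set L * L}).
Hypothesis disjXY : [disjoint X & Y].
Hypothesis lab_sides : forall x l, lab x = Some l -> l \in X :|: Y.
Hypothesis sub_E : E \subset setX X Y.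
Hypothesis E_edge : forall e, e \in E ->
  exists x, lab x = Some e.1 /\ lab (fl0 x) = Some e.2.

Definition left_side (o : option L) := oapp (mem X) false o.

Definition crossing x :=
  [/\ lab x : bool, lab (fl0 x) : bool & left_side (lab (fl0 x)) = ~~ left_side (lab x)].

Definition simple_crossing B :=
  [/\ edge_set B, {in B, forall x, crossing x} &
      {in B &, forall x y, lab x = lab y -> lab (fl0 x) = lab (fl0 y) ->
                           y = x \/ y = fl2 x}].

Lemma lab_fl1 x : lab (fl1 x) = lab x.
Proof. by apply/esym/lab_vertex; rewrite /vertex_rel /= eqxx. Qed.

Lemma lab_fl2 x : lab (fl2 x) = lab x.
Proof. by apply/esym/lab_vertex; rewrite /vertex_rel /= eqxx orbT. Qed.

Lemma edge_set_inner : edge_set inner_edges.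
Proof.
apply/edge_setP; split=> x; rewrite !inE ?fl02C ?lab_fl2 ?fl0K //.
by rewrite [RHS]andbC eq_sym; case: eqP => [->|]; rewrite ?andbT ?andbF.
Qed.

Definition ends_from_left x :=
  if left_side (lab x) then (lab x, lab (fl0 x)) else (lab (fl0 x), lab x).

Definition edge_cell_over (e : L * L) : {set M} :=
  oapp (@edge_orbit M) set0
    [pick x | [&& e \in E, lab x == Some e.1 & lab (fl0 x) == Some e.2]].

Lemma edge_cell_overP e x : x \in edge_cell_over e ->
  [/\ e \in E, crossing x, ends_from_left x = (Some e.1, Some e.2) &
      edge_cell_over e = edge_orbit x].
Proof.
rewrite /edge_cell_over; case: pickP => [d /and3P[eE /eqP ld /eqP ld0]|_] /=; last first.
  by rewrite in_set0.
move=> xd; have -> : edge_orbit d = edge_orbit x.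
  apply/setP=> y; rewrite -!connect_edge_cell.
  by apply: same_connect; [exact: edge_cell_rel_sym | rewrite connect_edge_cell].
have /andP[e1X e2Y] : (e.1 \in X) && (e.2 \in Y) by have := subsetP sub_E e eE; rewrite inE.
have e2X : e.2 \in X = false by apply: disjointFl disjXY e2Y.
rewrite /crossing /ends_from_left; move: xd; rewrite !inE.
case/orP=> [/orP[/orP[]|]|] /eqP->;
  by rewrite ?fl0K ?lab_fl2 ?fl02C ?lab_fl2 -?fl02C ?fl0K ?lab_fl2 ?ld ?ld0 /= e1X e2X.
Qed.

Lemma edge_set_over e : edge_set (edge_cell_over e).
Proof.
rewrite /edge_cell_over; case: pickP => [d _|_] /=; first exact: edge_set_orbit.
exact: edge_set0.
Qed.

Lemma edge_cell_over_inj e e' x y :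
  x \in edge_cell_over e -> y \in edge_cell_over e' ->
  ends_from_left x = ends_from_left y -> e = e'.
Proof.
move=> /edge_cell_overP[_ _ -> _] /edge_cell_overP[_ _ -> _] [e1 e2].
by rewrite (surjective_pairing e) e1 e2 -surjective_pairing.
Qed.

Definition crossing_cells : {set M} := \bigcup_e edge_cell_over e.

Lemma simple_crossing_cells : simple_crossing crossing_cells.
Proof.
split=> [x y xy|x /bigcupP[e _ /edge_cell_overP[]] //|x y].
  apply/bigcupP/bigcupP=> -[e _ over_e]; exists e => //;
  by move: over_e; rewrite (edge_set_over e xy).
move=> /bigcupP[e _ xe] /bigcupP[e' _ ye'] lxy lxy0.
have [_ [_ _ cross] _ cell_x] := edge_cell_overP xe.
have ee' : e = e'.
  by apply: edge_cell_over_inj xe ye' _; rewrite /ends_from_left lxy lxy0.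
have noloop : lab (fl0 x) <> lab x by move=> loop; move: cross; rewrite loop; case: left_side.
move: ye'; rewrite -ee' cell_x !inE => /orP[/orP[/orP[]|]|] /eqP yE; rewrite yE in lxy *.
- by left.
- by case: noloop.
- by right.
- by case: noloop; rewrite lxy fl02C lab_fl2.
Qed.

Lemma card_crossing_cells : #|crossing_cells| = #|E| * 4.
Proof.
have disj e e' : e != e' -> [disjoint edge_cell_over e & edge_cell_over e'].
  apply: contraNT => /pred0Pn[x /andP[xe xe']]; apply/eqP.
  exact: edge_cell_over_inj xe xe' _.
have := @partition_disjoint_bigcup _ _ nat 0 addn edge_cell_over (fun=> 1) disj.
rewrite sum1_card => ->; rewrite -sum_nat_const [RHS]big_mkcond; apply: eq_bigr => e _.
rewrite sum1_card; case: ifPn => eE.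
  rewrite /edge_cell_over; case: pickP => [d _|no_dart] /=; first exact: card_edge_orbit.
  by have [x [lx lx0]] := E_edge eE; have := no_dart x; rewrite eE lx lx0 !eqxx.
by apply: eq_card0 => x; apply/negP=> /edge_cell_overP[]; rewrite (negPf eE).
Qed.

Lemma crossing_outer x : crossing x -> x \notin inner_edges.
Proof.
by case=> lx _ cross; rewrite inE lx; apply/eqP => loop; move: cross; rewrite loop; case: left_side.
Qed.

Section Regions.
Variables F B : {set M}.
Hypotheses (sub_F : F \subset inner_edges) (eF : edge_set F).
Hypothesis F_cotree : forall x y, connect (region_rel F) x y.
Hypothesis F_spanning : forall x y, connect (graph_rel inner_edges) x y ->
  connect (graph_rel F) x y.
Hypothesis simple_B : simple_crossing B.

Let eB : edge_set B. Proof. by case: simple_B. Qed.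

Let eFB : edge_set (F :|: B). Proof. exact: edge_setU eF eB. Qed.

Let crossB : {in B, forall x, crossing x}. Proof. by case: simple_B. Qed.

Lemma disjoint_forest_crossing : [disjoint F & B].
Proof.
rewrite disjoint_sym disjoint_subset; apply/subsetP=> x /crossB/crossing_outer.
by apply: contra; apply: (subsetP sub_F).
Qed.

Section OneRegion.
Variable S : {set M}.
Hypothesis clS : closed (region_rel (F :|: B)) S.

Let S_fl0 x : (fl0 x \in S) = (x \in S).
Proof. by have [-> _] := (closed2P _ _ _).1 (sub_closed (@sub_face_region _ _) clS). Qed.

Lemma boundary_region_sub : boundary S :\: F \subset B.
Proof.
apply/subsetP=> x; rewrite 2!inE => /and3P[xF xS]; apply: contraR => xB.
have step : region_rel (F :|: B) x (fl2 x).
  by rewrite /= in_setC in_setU negb_or xF xB eqxx !orbT.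
by rewrite -(clS step).
Qed.

Lemma boundary_region_mate : {in boundary S :\: F, forall x,
  exists2 y, y \in (boundary S :\: F) :\ x & lab y = lab x}.
Proof.
move=> x xD; pose K := [set y | lab y == lab x].
have clK : closed (@vertex_rel M) K by move=> y z /lab_vertex; rewrite !inE => ->.
have KF : {in F, forall y, fl0 y \in K = (y \in K)}.
  by move=> y /(subsetP sub_F); rewrite !inE => /andP[_ /eqP->].
have := even_boundary (sub_closed (@sub_face_region _ _) clS) clK eF KF.
rewrite -setIDAC (cardsD1 x) in_setI xD inE eqxx /= negbK => odd_rest.
have [rest0|[y]] := set_0Vmem (((boundary S :\: F) :&: K) :\ x).
  by rewrite rest0 cards0 in odd_rest.
case/setD1P=> yx /setIP[yD]; rewrite inE => /eqP ly.
by exists y; rewrite // in_setD1 yx.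
Qed.

Lemma boundary_region_neq0 : S != set0 -> S != setT -> boundary S :\: F != set0.
Proof.
case/set0Pn=> r rS; apply: contra_neq => no_boundary; apply/setP=> y; rewrite in_setT.
have clSF : closed (region_rel F) S.
  apply: (intro_closed (region_rel_sym eF)) => u v /= /or3P[/eqP<-|/eqP<-|].
  - by rewrite S_fl0.
  - by rewrite -(clS (x := u)) //= eqxx orbT.
  case/andP=> uF /eqP<- uS; apply: contraT => u2S; have := in_set0 u.
  by rewrite -no_boundary in_setD inE uS u2S andbT -in_setC uF.
by rewrite -(closed_connect clSF (F_cotree r y)).
Qed.

(* After contraction the boundary of a region is an even subgraph of a simple
   bipartite graph, hence has at least four edges, with two flags in [S] each. *)
Lemma card_region_crossings : S != set0 -> S != setT -> 8 <= #|B :&: S|.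
Proof.
move=> S_neq0 S_neqT; have [_ _ simple] := simple_B.
have inB := subsetP boundary_region_sub.
have [F_fl0 _] := (edge_setP _).1 eF.
have D_fl0 : {in boundary S :\: F, forall x, fl0 x \in boundary S :\: F}.
  by move=> x; rewrite !inE -fl02C !S_fl0 F_fl0.
apply: (leq_trans (card_bipartite_darts (@fl0K M) D_fl0 (side := left_side) (lab := lab) _ _ _ _)).
- by move=> x /inB/crossB[].
- move=> x y xD yD lxy lxy0.
  have [//|yx] := simple x y (inB x xD) (inB y yD) lxy lxy0.
  by move: xD yD; rewrite yx !inE fl2K => /and3P[_ -> _] /and3P[].
- exact: boundary_region_mate.
- exact: boundary_region_neq0.
apply/subset_leq_card/subsetP=> x xD; rewrite in_setI inB //.
by move: xD; rewrite !inE => /and3P[].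
Qed.

End OneRegion.

Lemma n_comp_crossings : B != set0 ->
  n_comp (graph_rel F) M + 1 <= n_comp (graph_rel (F :|: B)) M + #|X :|: Y|.
Proof.
case/set0Pn=> b bB; pose labelled : {pred M} := [pred x | lab x : bool].
have clFB : closed (graph_rel (F :|: B)) labelled.
  move=> u v /= /or3P[/eqP<-|/eqP<-|]; rewrite !inE ?lab_fl1 ?lab_fl2 //.
  case/andP=> + /eqP<- => /orP[/(subsetP sub_F)|/crossB[-> -> _] //].
  by rewrite inE => /andP[_ /eqP->].
have clF : closed (graph_rel F) labelled.
  by apply: sub_closed clFB => u v /= /or3P[->|->|/andP[uF ->]]; rewrite ?in_setU ?uF ?orbT.
have unlabelled : n_comp (graph_rel F) [predC labelled]
                  = n_comp (graph_rel (F :|: B)) [predC labelled].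
  apply: eq_n_comp_in; [exact: predC_closed | exact: predC_closed |].
  move=> x nlx y /=; rewrite in_setU; case: (boolP (x \in B)) => [/crossB[lx _ _]|_].
    by rewrite !inE lx in nlx.
  by rewrite orbF.
have branches : n_comp (graph_rel F) labelled <= #|X :|: Y|.
  apply: leq_trans (leq_imset_card some _).
  apply: (leq_n_comp_label (graph_rel_sym eF) (lab := lab)) => x.
    rewrite inE; case lx: (lab x) => [l|] // _; apply/imsetP; exists l => //.
    exact: lab_sides lx.
  by move=> y lx _ lxy; apply/F_spanning/lab_connected.
have : 0 < n_comp (graph_rel (F :|: B)) labelled.
  by apply: (n_comp_gt0 (graph_rel_sym eFB) clFB (x := b)); have [] := crossB bB.
rewrite (n_compC labelled (graph_rel F)) (n_compC labelled (graph_rel (F :|: B))).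
lia.
Qed.

Lemma leq_regions_crossings : 1 < n_comp (region_rel (F :|: B)) M ->
  n_comp (region_rel (F :|: B)) M * 8 <= #|B|.
Proof.
move=> many; have sym := region_rel_sym eFB; rewrite -sum_roots_const -(sum_card_components sym).
apply: leq_sum => r _; apply: card_region_crossings; first exact: component_closed.
  by apply/set0Pn; exists r; rewrite inE connect0.
apply: contraTneq many => compT; rewrite -leqNgt; apply/(n_compT_le1P sym) => x y.
have r_conn z : connect (region_rel (F :|: B)) r z by have := in_setT z; rewrite -compT inE.
by apply: (connect_trans _ (r_conn y)); rewrite sym.
Qed.

End Regions.

Lemma bipartite_minor_euler (g : nat) : euler_char M = (2 - g%:Z)%R -> 1 < #|E| ->
  #|E| + 4 <= 2 * (#|X| + #|Y|) + 2 * g.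
Proof.
move=> chi E_gt1; have simple_B := simple_crossing_cells; have cardB := card_crossing_cells.
move: (crossing_cells) simple_B cardB => B simple_B cardB.
have [F [sub_F eF F_cotree F_spanning]] := spanning_forest edge_set_inner.
have [eB _ _] := simple_B.
have B_neq0 : B != set0 by rewrite -card_gt0 cardB; lia.
have := leq_euler_subgraphs chi eF (edge_setU eF eB).
have := n_comp_crossings sub_F eF F_spanning simple_B B_neq0.
have -> : #|F :|: B| = #|F| + #|B|.
  by rewrite cardsU (disjoint_setI0 (disjoint_forest_crossing sub_F simple_B)) cards0 subn0.
have -> : #|X :|: Y| = #|X| + #|Y| by rewrite cardsU (disjoint_setI0 disjXY) cards0 subn0.
have := leq_regions_crossings sub_F eF F_cotree simple_B.
by case: leqP => [few _ | _ /(_ isT)]; lia.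
Qed.

End BipartiteMinor.

(** * Vertex-deleted subgraphs *)

Definition cut_rel (T : finType) (e : rel T) (X : {set T}) u v :=
  e u v && ((u \in X) != (v \in X)).
Arguments cut_rel {T} e X u v /.

Lemma connected_cut (T : finType) (e : rel T) :
  symmetric e -> (forall x y, connect e x y) ->
  exists X : {set T}, forall x y, connect (cut_rel e X) x y.
Proof.
move=> sym_e conn_e; have [x0 _|no_vertex] := pickP T; last first.
  by exists set0 => x; have := no_vertex x.
pose reach X := component (cut_rel e X) x0.
have sym_cut X : connect_sym (cut_rel e X).
  by apply: sym_connect_sym => u v /=; rewrite sym_e eq_sym.
have [X _ maxX] := @arg_maxnP _ set0 predT (fun X => #|reach X|) isT.
exists X; suff reach_closed : closed e (reach X).
  have x0_conn x : connect (cut_rel e X) x0 x.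
    by have := closed_connect reach_closed (conn_e x0 x); rewrite !inE connect0.
  by move=> x y; apply: connect_trans (x0_conn y); rewrite sym_cut.
apply: (intro_closed (sym_connect_sym sym_e)) => u v uv u_reach.
apply: contraT => v_unreach; pose Y := [set w | (w \in X) (+) (w \in reach X)].
have sub_cut : subrel (cut_rel e X) (cut_rel e Y).
  move=> a b ab; have := component_closed (sym_cut X) x0 ab.
  case/andP: ab => eab; rewrite /= eab [a \in Y]inE [b \in Y]inE => ab ->.
  by move: ab; case: (a \in X); case: (b \in X); case: (b \in _).
have sub_reach a : connect (cut_rel e X) x0 a -> connect (cut_rel e Y) x0 a.
  by apply: connect_sub => b c /sub_cut/connect1.
suff : #|reach X| < #|reach Y| by rewrite ltnNge => /negP[]; apply: maxX Y isT.
apply/proper_card/properP; split; first by apply/subsetP=> a; rewrite !inE; apply: sub_reach.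
exists v => //; rewrite inE; apply: connect_trans (connect1 _).
  by move: u_reach; rewrite inE; apply: sub_reach.
rewrite /= uv [u \in Y]inE [v \in Y]inE u_reach (negPf v_unreach) addbF addbT.
have uncut : ~~ cut_rel e X u v.
  by apply: contra v_unreach => /(component_closed (sym_cut X) x0) <-.
by move: uncut; rewrite /= uv negbK => /eqP->; case: (v \in X).
Qed.

Section VertexDeletion.
Variable G : sgraph.
Implicit Types (A X : {set G}) (a u v w x y : G).

Definition minus_rel A u v := [&& u \notin A, v \notin A & adj u v].
Arguments minus_rel A u v /.

(* One representative for each component of [G - A]. *)
Definition parts A : {set G} := [set x | (x \notin A) && roots (minus_rel A) x].

Definition nonseparating A := {in [predC A] &, forall x y, connect (minus_rel A) x y}.

Definition attachments A x : {set G} :=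
  [set a in A | [exists u, connect (minus_rel A) x u && adj a u]].

Definition part_degree A a := #|[set x in parts A | a \in attachments A x]|.

Definition incidences A : {set G * G} :=
  [set p | (p.1 \in parts A) && (p.2 \in attachments A p.1)].

Lemma minus_rel_sym A : connect_sym (minus_rel A).
Proof. by apply: sym_connect_sym => x y /=; rewrite adj_sym andbCA. Qed.

Lemma minus_rel_closed A : closed (minus_rel A) A.
Proof. by move=> x y /and3P[/negbTE-> /negbTE->]. Qed.

Lemma minus_relS A X : X \subset A -> subrel (minus_rel A) (minus_rel X).
Proof.
by move=> /subsetP sXA u v /and3P[uA vA uv]; apply/and3P; split=> //; apply: contra (sXA _) _.
Qed.

Lemma connect_minus_rel_in A a x : a \in A -> connect (minus_rel A) a x -> x = a.
Proof. by move=> aA /connectP[[|y p] /= +]; rewrite ?aA // => _ ->. Qed.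

Lemma root_minus_rel_in A a : a \in A -> fingraph.root (minus_rel A) a = a.
Proof. by move=> aA; apply: connect_minus_rel_in (connect_root _ a). Qed.

Lemma root_part A x : x \notin A -> fingraph.root (minus_rel A) x \in parts A.
Proof.
move=> xA; rewrite inE (roots_root (@minus_rel_sym A)) andbT.
by rewrite mem_root //; apply: minus_rel_closed.
Qed.

Lemma part_root A x : x \in parts A -> fingraph.root (minus_rel A) x = x.
Proof. by rewrite inE => /andP[_ /eqP]. Qed.

Lemma part_notin A x : x \in parts A -> x \notin A.
Proof. by rewrite inE => /andP[]. Qed.

Lemma disjoint_parts A : [disjoint parts A & A].
Proof. by rewrite disjoint_subset; apply/subsetP=> x /part_notin; rewrite inE. Qed.

Lemma card_parts A : #|parts A| = n_comp (minus_rel A) [predC A].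
Proof. by apply: eq_card => x; rewrite !inE andbC. Qed.

Lemma n_comp_minus_rel A : n_comp (minus_rel A) G = #|A| + #|parts A|.
Proof.
rewrite (n_compC A) card_parts; congr (_ + _); apply: eq_card => x; rewrite !inE.
by apply/andb_idl => xA; apply/eqP/root_minus_rel_in.
Qed.

Lemma nonseparatingP A : reflect (nonseparating A) (#|parts A| <= 1).
Proof.
rewrite card_parts; apply: (n_comp_le1P (@minus_rel_sym A)).
exact/predC_closed/minus_rel_closed.
Qed.

Lemma eq_attachments A x y :
  connect (minus_rel A) x y -> attachments A x = attachments A y.
Proof.
move=> xy; apply/setP=> a; rewrite !inE; congr (_ && _).
by apply: eq_existsb => u; rewrite (same_connect (@minus_rel_sym A) xy).
Qed.

Lemma attachments_sub A x : attachments A x \subset A.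
Proof. by apply/subsetP=> a /setIdP[]. Qed.

Lemma attachments_adj A a u : a \in A -> adj a u -> a \in attachments A u.
Proof. by move=> aA au; rewrite inE aA; apply/existsP; exists u; rewrite connect0. Qed.

Lemma card_attachments_ge r A x y : r_connected r G ->
  x \notin A -> y \notin A -> ~~ connect (minus_rel A) x y -> r <= #|attachments A x|.
Proof.
case=> _ conn_G xA yA; apply: contraNT; rewrite -ltnNge => few.
have notin z : z \notin A -> z \notin attachments A x.
  by apply: contra; apply/subsetP/attachments_sub.
have := conn_G _ few x y (notin x xA) (notin y yA); set e := (X in connect X).
have sym_e : connect_sym e by apply: (@minus_rel_sym (attachments A x)).
have cl_x : closed e (connect (minus_rel A) x).
  apply: (intro_closed sym_e) => u v /and3P[_ vx uv] xu; apply: (connect_trans xu (connect1 _)).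
  have uA : u \notin A by rewrite -(closed_connect (@minus_rel_closed A) xu).
  rewrite /= uA uv andbT; apply: contra vx => vA.
  by rewrite (eq_attachments xu) attachments_adj // adj_sym.
by move/(closed_connect cl_x); rewrite !inE connect0 => <-.
Qed.

Lemma card_incidences A : #|incidences A| = \sum_(x in parts A) #|attachments A x|.
Proof.
under eq_bigr => x _ do rewrite -sum1_card.
by rewrite pair_big_dep /= sum1dep_card; apply: eq_card => p; rewrite !inE.
Qed.

Lemma sum_part_degree A : \sum_(a in A) part_degree A a = #|incidences A|.
Proof.
rewrite card_incidences; under eq_bigr => a _ do rewrite /part_degree -sum1_card.
under [RHS]eq_bigr => x _ do rewrite -sum1_card.
rewrite [RHS](exchange_big_dep (mem A)) /=; last by move=> x a _ /setIdP[].
by apply: eq_bigr => a aA; apply: eq_bigl => x; rewrite inE.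
Qed.

Lemma card_incidences_ge r A : r_connected r G -> 1 < #|parts A| ->
  r * #|parts A| <= #|incidences A|.
Proof.
move=> Gr many; rewrite card_incidences mulnC -sum_nat_const; apply: leq_sum => x xp.
have /card_gt0P[y /setD1P[yx yp]] : 0 < #|parts A :\ x|.
  by move: many; rewrite (cardsD1 x) xp.
apply: (card_attachments_ge Gr (part_notin xp) (part_notin yp)).
by rewrite -(fingraph.root_connect (@minus_rel_sym A)) !part_root // eq_sym.
Qed.

Lemma part_degree_le1 A a x y : part_degree A a <= 1 -> x \notin A -> y \notin A ->
  a \in attachments A x -> a \in attachments A y -> connect (minus_rel A) x y.
Proof.
move=> /card_le1_eqP same_part xA yA ax ay.
apply/(fingraph.rootP (@minus_rel_sym A))/same_part; rewrite inE root_part //;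
by rewrite -(eq_attachments (connect_root _ _)).
Qed.

(* The components that [v] sees are joined together, and the others remain. *)
Lemma card_parts_put_back A v : v \in A ->
  #|parts (A :\ v)| + part_degree A v <= #|parts A| + 1.
Proof.
move=> vA; pose e := minus_rel A; pose e' := minus_rel (A :\ v).
have sym' : connect_sym e' := @minus_rel_sym (A :\ v).
have sub : subrel e e' by apply/minus_relS/subsetDl.
pose V : {pred G} := connect e' v.
have clV' : closed e' V by apply: connect_closed.
have clV : closed e V := sub_closed sub clV'.
have outside : n_comp e [predC V] = n_comp e' [predC V].
  apply: eq_n_comp_in; [exact: predC_closed | exact: predC_closed |] => u uV w.
  have nv z : z \notin V -> z != v by apply: contraNneq => ->; apply: connect0.
  apply/idP/idP => [/sub //|uw]; have wV : w \notin V by rewrite -(clV' _ _ uw).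
  by move: uw; rewrite /e' /= !in_setD1 (nv _ uV) (nv _ wV).
have inside : part_degree A v < n_comp e V.
  have vp : v \notin [set x in parts A | v \in attachments A x] by rewrite !inE vA.
  rewrite -[_.+1]/(1 + _)%N.
  apply: (@leq_trans #|v |: [set x in parts A | v \in attachments A x]|).
    by rewrite cardsU1 vp.
  apply/subset_leq_card/subsetP=> x /setU1P[->|/setIdP[xp]].
    by rewrite inE /= /roots root_minus_rel_in // eqxx; apply: connect0.
  rewrite inE => /andP[_ /existsP[u /andP[xu vu]]]; apply/andP; split.
    exact/eqP/part_root.
  have uA : u \notin A by rewrite -(closed_connect (@minus_rel_closed A) xu) part_notin.
  apply: (@connect_trans _ _ u).
    by apply: connect1; rewrite /e' /= !in_setD1 eqxx vu (negPf uA) andbF.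
  by rewrite sym'; apply: connect_sub xu => b c /sub/connect1.
have := n_compC V e; have := n_compC V e'.
rewrite outside (n_comp_connect sym') !n_comp_minus_rel (cardsD1 v A) vA; lia.
Qed.

Definition minus_inner_rel A u v := adj u v && ~~ ((u \in A) && (v \in A)).
Arguments minus_inner_rel A u v /.

Definition minus_inner_connected A := forall x y, connect (minus_inner_rel A) x y.

Lemma minus_inner_connectedS A X :
  X \subset A -> minus_inner_connected A -> minus_inner_connected X.
Proof.
move=> /subsetP sXA connA x y; apply: connect_sub (connA x y) => u v /= /andP[uv nA].
by apply: connect1; rewrite /= uv; apply: contra nA => /andP[/sXA-> /sXA->].
Qed.

Lemma minus_inner_neighbour A a : 1 < #|G| -> minus_inner_connected A -> a \in A ->
  exists2 u, u \notin A & adj a u.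
Proof.
move=> G_gt1 connA aA.
have /card_gt0P[y ya] : 0 < #|predC1 a| by rewrite cardC1; lia.
have /connectP[[|u p] /=] := connA a y; first by move=> _ E; rewrite E inE eqxx in ya.
by case/andP=> /andP[au]; rewrite aA /= => uA _ _; exists u.
Qed.

Lemma exists_merging_vertex A : minus_inner_connected A -> 1 < #|parts A| ->
  exists2 a, a \in A & 1 < part_degree A a.
Proof.
move=> connA; rewrite ltnNge => many; apply/exists_inP; move: many; apply: contraNT.
rewrite negb_exists_in => /forall_inP deg_le1; apply/nonseparatingP=> x y xA yA.
have deg1 a : a \in A -> part_degree A a <= 1 by move/deg_le1; rewrite -leqNgt.
have sym_inner : connect_sym (minus_inner_rel A).
  by apply: sym_connect_sym => u v /=; rewrite adj_sym [(u \in A) && _]andbC.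
pose C := [set u | if u \in A then u \in attachments A x else connect (minus_rel A) x u].
have clC : closed (minus_inner_rel A) C.
  apply: (intro_closed sym_inner) => u w /= /andP[uw]; rewrite [u \in C]inE [w \in C]inE.
  case: (boolP (u \in A)) => uA; case: (boolP (w \in A)) => //= wA _.
  - move=> ux; apply: (part_degree_le1 (deg1 u uA)) => //; exact: attachments_adj.
  - by move/eq_attachments->; apply: attachments_adj; rewrite // adj_sym.
  - by move=> xu; apply: connect_trans xu (connect1 _); rewrite /= uA wA.
have := closed_connect clC (connA x y); rewrite [x \in C]inE [y \in C]inE connect0.
by rewrite (negPf xA) (negPf yA) => <-.
Qed.

End VertexDeletion.

Arguments minus_rel {G} A u v /.
Arguments minus_inner_rel {G} A u v /.

Section Skeleton.
Variables (G : sgraph) (M : surface_map) (f : G -> M) (A : {set G}).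
Hypothesis f_inj : forall x y, same_vertex (f x) (f y) -> x = y.
Hypothesis f_adj : forall x y, adj x y ->
  exists d, same_vertex (f x) d /\ same_vertex (f y) (fl0 d).

Definition branch (d : M) : option G :=
  omap (fingraph.root (minus_rel A)) [pick v | same_vertex (f v) d].

Lemma branchE v d : same_vertex (f v) d -> branch d = Some (fingraph.root (minus_rel A) v).
Proof.
move=> vd; rewrite /branch; case: pickP => [w wd|/(_ v)]; last by rewrite vd.
congr (Some (fingraph.root _ _)); apply: f_inj; apply: connect_trans wd _.
by rewrite vertex_rel_sym.
Qed.

Lemma branch_Some d l : branch d = Some l ->
  exists2 v, same_vertex (f v) d & l = fingraph.root (minus_rel A) v.
Proof. by rewrite /branch; case: pickP => // v vd [<-]; exists v. Qed.

Lemma branch_vertex d d' : @vertex_rel M d d' -> branch d = branch d'.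
Proof.
move=> dd'; congr omap; apply: eq_pick => v.
by rewrite /same_vertex /= (same_connect1r (@vertex_rel_sym M) dd').
Qed.

Lemma branch_sides d l : branch d = Some l -> l \in parts A :|: A.
Proof.
case/branch_Some=> v _ ->; rewrite in_setU; have [vA|vA] := boolP (v \in A).
  by rewrite root_minus_rel_in // vA orbT.
by rewrite root_part.
Qed.

Lemma same_vertex_graph H d d' : same_vertex d d' -> connect (@graph_rel M H) d d'.
Proof. by apply: connect_sub => x y /sub_vertex_graph/connect1. Qed.

Lemma connect_branch v w : connect (minus_rel A) v w ->
  connect (graph_rel (inner_edges branch)) (f v) (f w).
Proof.
have sym := graph_rel_sym (edge_set_inner branch_vertex).
case/connectP=> p + ->; elim: p v => [|u p IHp] v /=; first by rewrite connect0.
case/andP=> vu /IHp; apply: connect_trans.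
have root_vu := fingraph.rootP (@minus_rel_sym _ A) (connect1 (vu : minus_rel A v u)).
have [_ _ /f_adj[d [vd ud]]] := and3P vu.
apply: connect_trans (same_vertex_graph _ vd) _; apply: (@connect_trans _ _ (fl0 d)).
  apply: connect1; rewrite /= inE (branchE vd) (branchE ud) root_vu !eqxx.
  by rewrite !orbT.
by rewrite sym; apply: same_vertex_graph.
Qed.

Lemma branch_connected d d' : branch d -> branch d = branch d' ->
  connect (graph_rel (inner_edges branch)) d d'.
Proof.
have sym := graph_rel_sym (edge_set_inner branch_vertex).
case bd: (branch d) => [l|] // _ /esym bd'.
have [v vd lv] := branch_Some bd; have [w wd' lw] := branch_Some bd'.
have vw : connect (minus_rel A) v w.
  by apply/(fingraph.rootP (@minus_rel_sym _ A)); rewrite -lv -lw.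
apply: connect_trans (connect_trans (connect_branch vw) (same_vertex_graph _ wd')).
by rewrite sym; apply: same_vertex_graph.
Qed.

Lemma incidence_dart e : e \in incidences A ->
  exists d, branch d = Some e.1 /\ branch (fl0 d) = Some e.2.
Proof.
case: e => x a; rewrite inE /= => /andP[xp].
rewrite inE => /andP[aA /existsP[u /andP[xu]]]; rewrite adj_sym => /f_adj[d [ud ad]].
exists d; rewrite (branchE ud) (branchE ad) (root_minus_rel_in aA).
by rewrite -(fingraph.rootP (@minus_rel_sym _ A) xu) part_root.
Qed.

End Skeleton.

Lemma has_euler_genus_map (G : sgraph) g : has_euler_genus G g ->
  exists2 M : surface_map, euler_char M = (2 - g%:Z)%R & in_skeleton G M.
Proof. by case=> -[S [[M [MS GM]] <-]] _; exists M => //; case: S MS => k []. Qed.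

Lemma parts_euler (G : sgraph) g r (A : {set G}) :
  has_euler_genus G g -> r_connected r G -> 0 < r -> 1 < #|parts A| ->
  r * #|parts A| + 4 <= 2 * (#|parts A| + #|A|) + 2 * g.
Proof.
move=> /has_euler_genus_map[M chi [f [f_inj f_adj]]] Gr r_gt0 many.
have card_inc := card_incidences_ge Gr many.
have inc_gt1 : 1 < #|incidences A| by nia.
have sub_inc : incidences A \subset setX (parts A) A.
  by apply/subsetP=> e; rewrite !inE => /andP[-> /andP[]].
apply: leq_trans (leq_add card_inc (leqnn 4)) _.
exact: (bipartite_minor_euler (branch_vertex f A) (branch_connected f_inj f_adj)
  (disjoint_parts A) (@branch_sides _ _ f A) sub_inc (incidence_dart f_inj f_adj) chi inc_gt1).
Qed.

(** * Spanning trees with prescribed leaves *)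

Section LeafTree.
Variable G : sgraph.
Implicit Types (F : {set {set G}}) (A : {set G}) (x y : G).

Lemma edge_rel_sym F : connect_sym (edge_rel F).
Proof. by apply: sym_connect_sym => x y; rewrite /edge_rel /= setUC. Qed.

Lemma adj_edges x y : adj x y -> [set x; y] \in edges G.
Proof. by move=> xy; apply/imsetP; exists (x, y); rewrite ?inE. Qed.

Lemma cycle_edge_not_bridge F x y z s : ucycle (edge_rel F) [:: x, y, z & s] ->
  connect (edge_rel (F :\ [set x; y])) x y.
Proof.
case/andP=> /= /and3P[_ yz zx].
rewrite !inE !negb_or => /and3P[/and3P[nxy nxz _] /andP[nyz ys] _].
rewrite edge_rel_sym; apply: (@connect_trans _ _ z).
  apply: connect1; rewrite /edge_rel /= in_setD1 andbC; apply/andP; split=> //.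
  by apply: contraNneq nxz => /setP/(_ z); rewrite !inE eqxx orbT !(eq_sym z) (negPf nyz) orbF.
apply/connectP; exists (rcons s x); last by rewrite last_rcons.
apply: (@sub_in_path _ (predC1 y) (edge_rel F)) zx => [u v uy vy uv|].
  rewrite /edge_rel /= in_setD1 andbC; apply/andP; split=> //.
  apply: contraTneq uy => /setP/(_ y); rewrite !inE eqxx orbT => /orP[/eqP->|/eqP yv].
    by rewrite eqxx.
  by rewrite yv inE eqxx in vy.
rewrite /= all_rcons /= eq_sym nyz nxy; apply/allP=> u us.
by apply: contraNneq ys => <-.
Qed.

Lemma exists_spanning_tree (E : {set {set G}}) :
  E \subset edges G -> (forall x y, connect (edge_rel E) x y) ->
  exists2 F : {set {set G}}, F \subset E & F \in spanning_trees G.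
Proof.
move=> sub_E connE; pose spans F := [forall x, forall y, connect (edge_rel F) x y].
have spansE : spans E by apply/forallP=> x; apply/forallP=> y.
have [F /minsetP[/forallP spansF minF] sub_F] := minset_exists spansE.
have connF x y : connect (edge_rel F) x y by apply: (forallP (spansF x)).
exists F; rewrite // inE; apply/asboolP; split=> //; first exact: subset_trans sub_F sub_E.
move=> [|x [|y [|z s]]] // cyc; exfalso; have not_bridge := cycle_edge_not_bridge cyc.
suff /minF/(_ (subsetDl _ _)) FE : spans (F :\ [set x; y]).
  by case/andP: cyc => /= /andP[xy _] _; move: xy; rewrite /edge_rel /= -FE setD11.
apply/forallP=> u; apply/forallP=> v; apply: connect_sub (connF u v) => {}u {}v uv.
have [uvE|ne] := eqVneq [set u; v] [set x; y]; last first.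
  by apply: connect1; rewrite /edge_rel /= in_setD1 ne.
have /set2P u_xy : u \in [set x; y] by rewrite -uvE set21.
have /set2P v_xy : v \in [set x; y] by rewrite -uvE set22.
by case: u_xy v_xy => -> [] -> //; rewrite edge_rel_sym.
Qed.

Lemma leaf_unique_edge F x y (e : {set G}) :
  connect (edge_rel F) x y -> x != y ->
  {in F, forall f : {set G}, x \in f -> f = e} -> x \in leaves F.
Proof.
case/connectP=> [[|u p] /=]; first by move=> _ ->; rewrite eqxx.
case/andP=> xu _ _ _ unique; rewrite inE; apply/cards1P; exists e.
have eE := unique _ xu (set21 x u).
apply/setP=> f; rewrite !inE; apply/andP/eqP => [[fF /unique->]|->] //.
by rewrite -eE set21.
Qed.

Lemma spanning_tree_with_leaves A :
  nonseparating A -> {in A, forall a, exists2 u, u \notin A & adj a u} ->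
  exists2 F, F \in spanning_trees G & A \subset leaves F.
Proof.
move=> nonsep neighbour.
have [p pA] : exists p : G -> G, forall a, a \in A -> p a \notin A /\ adj a (p a).
  apply: (@fin_all_exists _ (fun=> G : Type) (fun a u => a \in A -> u \notin A /\ adj a u)) => a.
  by have [/neighbour[u]|] := boolP (a \in A); [exists u | exists a].
pose E := [set f in edges G | [disjoint f & A]] :|: [set [set a; p a] | a in A].
have pendant a : a \in A -> edge_rel E a (p a).
  by move=> aA; rewrite /edge_rel /= in_setU (imset_f (fun a => [set a; p a]) aA) orbT.
have sub_E : E \subset edges G.
  apply/subsetP=> f /setUP[/setIdP[]//|/imsetP[a /pA[_ apa] ->]]; exact: adj_edges.
have connE x y : connect (edge_rel E) x y.
  have outside u v : u \notin A -> v \notin A -> connect (edge_rel E) u v.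
    move=> uA vA; apply: connect_sub (nonsep u v uA vA) => {uA vA}u {}v /and3P[uA vA uv].
    apply: connect1; rewrite /edge_rel /= in_setU inE adj_edges //=.
    by rewrite disjoints_subset subUset !sub1set !in_setC uA vA.
  have exit u : exists2 v, v \notin A & connect (edge_rel E) u v.
    have [uA|uA] := boolP (u \in A); last by exists u.
    by exists (p u); [have [] := pA u uA | apply/connect1/pendant].
  have [[u uA xu] [v vA yv]] := (exit x, exit y).
  by rewrite (connect_trans xu) // (connect_trans (outside u v uA vA)) // edge_rel_sym.
have [F sub_F treeF] := exists_spanning_tree sub_E connE; exists F => //.
move: treeF; rewrite inE => /asboolP[_ connF _].
apply/subsetP=> a aA; have [paA _] := pA a aA.
apply: (leaf_unique_edge (connF a (p a)) (e := [set a; p a])).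
  by apply: contraNneq paA => <-.
move=> f /(subsetP sub_F)/setUP[/setIdP[_ disj] af|/imsetP[b bA ->]].
  by have := disjointFr disj af; rewrite aA.
case/set2P=> [->//|aE]; have [pbA _] := pA b bA.
by rewrite -aE aA in pbA.
Qed.

End LeafTree.

Local Open Scope ring_scope.

(** * The greedy procedure *)

Lemma bernoulli_inequality (R : realDomainType) (x : R) n :
  -1 <= x -> 1 + n%:R * x <= (1 + x) ^+ n.
Proof.
move=> x_ge; elim: n => [|n IHn]; first by rewrite mul0r addr0 expr0.
rewrite exprS; have : (1 + x) * (1 + n%:R * x) <= (1 + x) * (1 + x) ^+ n.
  by apply: ler_wpM2l IHn; lra.
by apply: le_trans; have : (0 : R) <= n%:R := ler0n R n; rewrite -natr1; nra.
Qed.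

Section Potential.
Variables (R : realFieldType) (r : nat).
Hypothesis r_gt2 : (2 < r)%N.

Definition loss i : R := (r.-1%:R * i.+1%:R)^-1.

Definition density n : R := \prod_(i < n) (1 - loss i).

(* A lower bound for the number of vertices that are still removed at the end of
   the greedy procedure, from a state with [z] removed vertices and [k] components:
   it is constant along the steps that merge [n.+2] components, and the choice of
   [loss n] makes it agree with [potential n.+1] where [r * k = n.+2 * z]. *)
Definition potential n (z k : R) := density n * (z - k / n.+1%:R).

Lemma densityS n : density n.+1 = density n * (1 - loss n).
Proof. by rewrite /density big_ord_recr. Qed.

Lemma loss_bounds i : 0 < loss i <= 2^-1.
Proof.
have prod_ge2 : 2 <= r.-1%:R * i.+1%:R :> R by rewrite -natrM ler_nat; nia.
have prod_gt0 : 0 < r.-1%:R * i.+1%:R :> R by apply: lt_le_trans prod_ge2.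
by rewrite /loss invr_gt0 prod_gt0 lef_pV2 ?posrE ?ltr0n.
Qed.

Lemma density_bounds n : 0 < density n <= 1.
Proof.
elim: n => [|n /andP[d0 d1]]; first by rewrite /density big_ord0 ltr01 lexx.
have /andP[l0 l2] := loss_bounds n; rewrite densityS.
by apply/andP; split; [apply: mulr_gt0; lra | nra].
Qed.

Lemma potential_le n (z k : R) : 0 <= z -> 0 <= k -> potential n z k <= z.
Proof.
move=> z0 k0; have /andP[d0 d1] := density_bounds n.
have k_ge0 : 0 <= k / n.+1%:R by rewrite divr_ge0.
apply: le_trans (ler_piMl z0 d1); apply: ler_wpM2l; first exact: ltW.
by rewrite lerBlDr lerDl.
Qed.

Lemma potential_scale n (c z k : R) : potential n (c * z) (c * k) = c * potential n z k.
Proof. by rewrite /potential -mulrA -mulrBr mulrCA. Qed.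

Lemma ler_potential n (z k z' k' : R) :
  z - k / n.+1%:R <= z' - k' / n.+1%:R -> potential n z k <= potential n z' k'.
Proof. by have /andP[d0 _] := density_bounds n; apply/ler_wpM2l/ltW. Qed.

Lemma potentialS_le n (z k : R) : r%:R * k <= n.+2%:R * z ->
  potential n.+1 z k <= potential n z k.
Proof.
have /andP[d0 _] := density_bounds n.
rewrite /potential densityS -mulrA ler_pM2l // /loss.
have -> : r%:R = r.-1%:R + 1 :> R by rewrite natr1 prednK //; lia.
have : 0 < r.-1%:R :> R by rewrite ltr0n; lia.
have : 0 <= n%:R :> R by [].
rewrite -(natr1 n.+1) -(natr1 n); move: (r.-1%:R) (n%:R) => m x x0 m0 h; rewrite -subr_ge0.
have -> : z - k / (x + 1) - (1 - (m * (x + 1))^-1) * (z - k / (x + 1 + 1))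
          = ((x + 1 + 1) * z - (m + 1) * k) / (m * (x + 1) * (x + 1 + 1)).
  by field; rewrite !lt0r_neq0 //; lra.
by rewrite divr_ge0 ?mulr_ge0 //; lra.
Qed.

Lemma potential_antitone d n (z k : R) : (d <= n)%N -> 0 <= z ->
  r%:R * k <= d.+2%:R * z -> potential n z k <= potential d z k.
Proof.
move=> dn z0 rk; rewrite -(subnK dn); elim: (n - d)%N => [|i IHi]; first exact: lexx.
apply: le_trans (potentialS_le _) IHi; apply: le_trans rk _.
by rewrite ler_wpM2r // ler_nat !ltnS leq_addl.
Qed.

Lemma potential_put_back n (z k k' d : nat) : (1 < d)%N ->
  (r * k <= z.+1 * d)%N -> (k' + d <= k + 1)%N ->
  exists n', potential n z.+1%:R k%:R <= potential n' z%:R k'%:R.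
Proof.
case: d => [|[|d]] // _ rk k'd.
have gain i : (i <= d)%N -> potential i z.+1%:R k%:R <= potential i z%:R k'%:R.
  move=> id; apply: ler_potential; have i0 : (0 : R) < i.+1%:R by [].
  have : (k' + i.+1)%:R / i.+1%:R <= k%:R / i.+1%:R :> R.
    by rewrite ler_pM2r ?invr_gt0 // ler_nat; lia.
  rewrite natrD mulrDl divff ?lt0r_neq0 // -(natr1 z).
  by move: (k%:R / _) (k'%:R / _) => a b; lra.
have [nd|dn] := leqP n d; first by exists n; apply: gain.
exists d; apply: le_trans (gain d (leqnn d)); apply: potential_antitone (ltnW dn) _ _ => //.
by rewrite -!natrM ler_nat [(d.+2 * _)%N]mulnC.
Qed.

Lemma density_le_potential n (z k : R) : 0 <= z -> 2 * k <= n.+1%:R * z ->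
  density n * z <= 2 * potential n z k.
Proof.
move=> z0; rewrite -ler_pdivrMl // mulrCA [_^-1 * k]mulrC => kz.
have /andP[d0 _] := density_bounds n.
by rewrite /potential mulrCA ler_pM2l //; move: (k / _) kz => q; lra.
Qed.

Lemma density_exp_lower n : 1 <= (2 * density n.+1) ^+ r.-1 * n.+1%:R.
Proof.
elim: n => [|n IHn].
  rewrite mulr1 densityS /density big_ord0; apply: exprn_ege1.
  by have /andP[_ l2] := loss_bounds 0; lra.
rewrite densityS mulrA exprMn; apply: (le_trans IHn); rewrite -mulrA.
apply: ler_wpM2l; first by have /andP[d0 _] := density_bounds n.+1; apply: exprn_ge0; lra.
have /andP[l0 l2] := loss_bounds n.+1.
have /(bernoulli_inequality r.-1) : - 1 <= - loss n.+1 by lra.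
have -> : r.-1%:R * - loss n.+1 = - n.+2%:R^-1.
  by rewrite /loss mulrN invfM mulrA divff ?mul1r // pnatr_eq0; lia.
move=> le_pow; apply: (@le_trans _ _ ((1 - n.+2%:R^-1) * n.+2%:R)).
  by rewrite mulrBl mul1r mulVf ?pnatr_eq0 // -(natr1 n.+1); lra.
by rewrite ler_wpM2r.
Qed.

(* The constant 27 comes from [r.-1 >= 2] and [(8 / 27) ^+ 2 < 6^-1]. *)
Lemma density_lower n (s : R) : 1 <= s -> n.+1%:R <= 6 * s ^+ r.-1 ->
  4 <= 27 * (density n.+1 * s).
Proof.
move=> s1 n_le; have /andP[d0 d1] := density_bounds n.+1; rewrite leNgt; apply/negP=> small.
have small_pow : (2 * density n.+1 * s) ^+ r.-1 <= (8 / 27) ^+ 2.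
  apply: (@le_trans _ _ ((8 / 27) ^+ r.-1)).
    by rewrite lerXn2r ?nnegrE ?mulr_ge0 //; lra.
  by apply: ler_wiXn2l; [lra | lra | lia].
have := density_exp_lower n; apply/negP; rewrite -ltNge.
apply: (@le_lt_trans _ _ ((2 * density n.+1 * s) ^+ r.-1 * 6)); last by lra.
rewrite [X in _ <= X * _]exprMn -mulrA; apply: ler_wpM2l; last by rewrite mulrC.
by apply: exprn_ge0; lra.
Qed.

End Potential.

Section Greedy.
Variables (R : realFieldType) (G : sgraph) (r : nat).
Hypotheses (r_gt2 : (2 < r)%N) (Gr : r_connected r G).
Implicit Types (A X : {set G}).

Lemma exists_max_degree_vertex A : minus_inner_connected A -> (1 < #|parts A|)%N ->
  exists v, [/\ v \in A, (1 < part_degree A v)%N &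
                (r * #|parts A| <= #|A| * part_degree A v)%N].
Proof.
move=> connA many; have [a aA a_merging] := exists_merging_vertex connA many.
have [v vA maxv] := @arg_maxnP _ a (mem A) (part_degree A) aA.
exists v; split=> //; first exact: leq_trans a_merging (maxv a aA).
apply: leq_trans (card_incidences_ge Gr many) _.
by rewrite -sum_part_degree -sum_nat_const; apply: leq_sum => b /maxv.
Qed.

Lemma greedy_nonseparating A n : minus_inner_connected A ->
  exists X, [/\ X \subset A, nonseparating X &
                potential r n #|A|%:R #|parts A|%:R <= #|X|%:R :> R].
Proof.
have [m] := ubnP #|A|; elim: m A n => // m IHm A n lt_m connA.
have [few|many] := leqP #|parts A| 1.
  by exists A; split; [| exact/nonseparatingP | exact: potential_le].
have [v [vA merging rk]] := exists_max_degree_vertex connA many.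
have sub_A : A :\ v \subset A by apply: subsetDl.
have cardA : #|A| = #|A :\ v|.+1 by rewrite (cardsD1 v A) vA.
rewrite cardA in rk.
have [n' le_n'] := potential_put_back R r_gt2 n merging rk (card_parts_put_back vA).
have [|X [sub_X nonsepX leX]] := IHm (A :\ v) n' _ (minus_inner_connectedS sub_A connA).
  by rewrite -ltnS -cardA.
exists X; split=> //; first exact: subset_trans sub_X sub_A.
by rewrite cardA; apply: le_trans le_n' leX.
Qed.

End Greedy.

(** * Robust connectivity *)

Lemma r_connected_connect r (G : sgraph) (x y : G) :
  (0 < r)%N -> r_connected r G -> connect adj x y.
Proof.
move=> r_gt0 [_ /(_ set0)]; rewrite cards0 => /(_ r_gt0 x y).
rewrite !inE => /(_ isT isT); apply: connect_sub => u v /and3P[_ _ uv]; exact: connect1.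
Qed.

Lemma minus_inner_connected_half (G : sgraph) (K : {set G}) :
  (forall x y : G, connect adj x y) ->
  exists A : {set G}, [/\ A \subset K, minus_inner_connected A & (#|K| <= 2 * #|A|)%N].
Proof.
move=> connG; have [X cutX] := connected_cut (@adj_sym G) connG.
have one_side (A : {set G}) : {in A &, forall u v, (u \in X) = (v \in X)} ->
    minus_inner_connected A.
  move=> sideA x y; apply: connect_sub (cutX x y) => u v /= /andP[uv cut_uv].
  by apply: connect1; rewrite /= uv; apply: contra cut_uv => /andP[uA vA]; rewrite (sideA u v).
have := cardsID X K; have [le|lt] := leqP #|K :\: X| #|K :&: X| => cardK.
  exists (K :&: X); split; [exact: subsetIl | | lia].
  by apply: one_side => u v /setIP[_ ->] /setIP[_ ->].
exists (K :\: X); split; [exact: subsetDl | | lia].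
by apply: one_side => u v /setDP[_ /negPf->] /setDP[_ /negPf->].
Qed.

Lemma robust_connectivity_ge (R : realType) (G : sgraph) (t : R) :
  (1 < #|G|)%N -> (forall x y : G, connect adj x y) ->
  (forall A : {set G}, A != set0 -> minus_inner_connected A ->
     exists X : {set G}, [/\ X \subset A, nonseparating X & t * 2 * #|A|%:R <= #|X|%:R]) ->
  t <= robust_connectivity G R.
Proof.
move=> G_gt1 connG nonsep.
have many_leaves (K : {set G}) : K != set0 ->
    exists2 F, F \in spanning_trees G & t * #|K|%:R <= #|K :&: leaves F|%:R.
  rewrite -card_gt0 => K_gt0; have [A [sub_A connA leK]] := minus_inner_connected_half K connG.
  have [|X [sub_X nonsepX leX]] := nonsep A _ connA; first by rewrite -card_gt0; lia.
  have [F treeF leavesF] := spanning_tree_with_leaves nonsepX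
    (fun a => minus_inner_neighbour G_gt1 (minus_inner_connectedS sub_X connA)).
  exists F => //; have [t_le0|t_gt0] := lerP t 0.
    by apply: le_trans (ler0n _ _); rewrite mulr_le0_ge0.
  apply: (@le_trans _ _ #|X|%:R).
    apply: le_trans leX; rewrite -mulrA -natrM; apply: ler_wpM2l; first exact: ltW.
    by rewrite ler_nat.
  by rewrite ler_nat subset_leq_card // subsetI (subset_trans sub_X).
rewrite /robust_connectivity; apply: le_bigmin => [|K K0].
  have G_gt0 : 0 < #|[set: G]|%:R :> R by rewrite ltr0n cardsT ltnW.
  have [|F _] := many_leaves [set: G]; first by rewrite -card_gt0 -(ltr0n R).
  rewrite setTI => leF; rewrite -(ler_pM2r G_gt0) mul1r.
  by apply: le_trans leF _; rewrite ler_nat subset_leq_card ?subsetT.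
have [F treeF leF] := many_leaves K K0.
by apply: (bigmax_sup F) => //; rewrite ler_pdivlMr // ltr0n card_gt0.
Qed.

Section Bounds.
Variables (R : realType) (G : sgraph) (r g : nat).
Hypotheses (r_gt2 : (2 < r)%N) (Gr : r_connected r G) (genus : has_euler_genus G g).
Implicit Types A : {set G}.

Let r_gt0 : (0 < r)%N. Proof. exact: leq_trans r_gt2. Qed.

Let G_gt1 : (1 < #|G|)%N. Proof. by case: Gr => lt_r _; lia. Qed.

Let connG (x y : G) : connect adj x y. Proof. exact: r_connected_connect r_gt0 Gr. Qed.

Lemma parts_le_low_genus A : (g <= 2)%N -> (1 < #|parts A|)%N ->
  #|parts A|%:R <= #|A|%:R * (2 / (r%:R - 2)) :> R.
Proof.
move=> g_le2 /(parts_euler genus Gr r_gt0) euler.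
have r2 : 0 < r%:R - 2 :> R by rewrite subr_gt0 ltr_nat.
rewrite mulrA ler_pdivlMr // mulrBr -!natrM lerBlDr -natrD ler_nat; lia.
Qed.

Lemma robust_connectivity_ge_potential n : (g <= 2)%N ->
  potential r n 1 (2 / (r%:R - 2)) / 2 <= robust_connectivity G R.
Proof.
move=> g_le2; apply: robust_connectivity_ge => // A _ connA; rewrite divfK ?pnatr_eq0 // mulrC.
have [few|many] := leqP #|parts A| 1.
  exists A; split=> //; first exact/nonseparatingP.
  rewrite -[leRHS]mulr1 ler_wpM2l // potential_le // divr_ge0 // subr_ge0 ler_nat; lia.
have [X [sub_X nonsepX leX]] := greedy_nonseparating R r_gt2 Gr n connA.
exists X; split=> //; apply: le_trans leX; rewrite -potential_scale mulr1.
apply: ler_potential => //; rewrite lerD2l lerN2 ler_pM2r ?invr_gt0 //.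
exact: parts_le_low_genus.
Qed.

Lemma parts_quotient_le A (s : R) : 1 <= s -> g.+1%:R <= s ^+ r ->
  27 * s < 2 * #|A|%:R -> (1 < #|parts A|)%N ->
  ((2 * #|parts A|) %/ #|A|).+1%:R <= 6 * s ^+ r.-1.
Proof.
move=> s1; have -> : s ^+ r = s * s ^+ r.-1 by rewrite -exprS prednK.
move=> s_pow large many.
have parts_le : #|parts A|%:R <= 2 * #|A|%:R + 2 * g.+1%:R :> R.
  rewrite -!natrM -natrD ler_nat; have := parts_euler genus Gr r_gt0 many.
  have : (3 * #|parts A| <= r * #|parts A|)%N by rewrite leq_mul2r r_gt2 orbT.
  by move: (r * _)%N => rk; lia.
have quotient_le : ((2 * #|parts A|) %/ #|A|)%:R * #|A|%:R <= 2 * #|parts A|%:R :> R.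
  by rewrite -!natrM ler_nat leq_divM.
have sm1 : 1 <= s ^+ r.-1 by apply: exprn_ege1.
rewrite -natr1; move: (s ^+ r.-1) (_ %/ _)%:R sm1 s_pow quotient_le => sm q sm1 s_pow q_le.
move: (#|A|%:R) (#|parts A|%:R) large parts_le q_le => z k large k_le q_le.
suff : q * z <= (4 + sm * (8 / 27)) * z by rewrite ler_pM2r; lra.
have : s * sm <= 2 / 27 * z * sm by apply: ler_wpM2r; lra.
lra.
Qed.

Lemma large_nonseparating A (s : R) : 1 <= s -> g.+1%:R <= s ^+ r ->
  A != set0 -> minus_inner_connected A ->
  exists X : {set G}, [/\ X \subset A, nonseparating X & 2 * #|A|%:R <= 27 * s * #|X|%:R].
Proof.
move=> s1 s_pow /set0Pn[a aA] connA.
have [small|large] := leP (2 * #|A|%:R) (27 * s).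
  exists [set a]; rewrite sub1set cards1 mulr1; split=> // x y xa ya.
  by case: Gr => _; apply; rewrite // cards1; apply: ltn_trans r_gt2.
have [few|many] := leqP #|parts A| 1.
  exists A; split=> //; first exact/nonseparatingP.
  by rewrite ler_wpM2r //; lra.
have A_gt0 : (0 < #|A|)%N by apply/card_gt0P; exists a.
pose q := ((2 * #|parts A|) %/ #|A|)%N.
have parts_le : 2 * #|parts A|%:R <= q.+2%:R * #|A|%:R :> R.
  rewrite -!natrM ler_nat; apply: leq_trans (ltnW (ltn_ceil _ A_gt0)) _.
  by rewrite leq_mul2r leqnSn orbT.
have [X [sub_X nonsepX leX]] := greedy_nonseparating R r_gt2 Gr q.+1 connA.
exists X; split=> //.
have := density_le_potential r_gt2 (ler0n R #|A|) parts_le.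
have := density_lower r_gt2 s1 (parts_quotient_le s1 s_pow large many).
have := ler0n R #|A|; rewrite -/q; move: (density _ _ _) => d; nra.
Qed.

Lemma robust_connectivity_ge_genus :
  27^-1 * g.+1%:R `^ (- r%:R^-1) <= robust_connectivity G R.
Proof.
pose s : R := g.+1%:R `^ r%:R^-1; rewrite powRN -/s.
have s_pow : s ^+ r = g.+1%:R.
  by rewrite -powR_mulrn ?powR_ge0 // -powRrM mulVf ?powRr1 // pnatr_eq0 -lt0n.
have s1 : 1 <= s.
  by rewrite -[leLHS](powRr0 g.+1%:R); apply: ler_powR; rewrite ?ler1n ?invr_ge0.
apply: robust_connectivity_ge => // A A0 connA.
have [|X [sub_X nonsepX leX]] := large_nonseparating s1 _ A0 connA; first by rewrite s_pow.
exists X; split=> //; rewrite -invfM -mulrA ler_pdivrMl //; lra.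
Qed.

End Bounds.

Theorem theorem7 (R : realType) (r : nat) (G : sgraph) (g : nat)
  (hr : (3 <= r)%N) (hconn : r_connected r G) (hgenus : has_euler_genus G g) :
  27^-1 * (g.+1%:R `^ (- r%:R^-1)) <= robust_connectivity G R /\
  ((g <= 2)%N ->
    [/\ r = 3%N -> 21 / 256 <= robust_connectivity G R,
        r = 4%N -> 5 / 27 <= robust_connectivity G R,
        r = 5%N -> 49 / 192 <= robust_connectivity G R &
        r = 6%N -> 3 / 10 <= robust_connectivity G R]).
Proof.
split; first exact: robust_connectivity_ge_genus.
move=> g_le2; have low_genus n := robust_connectivity_ge_potential R hr hconn hgenus n g_le2.
split=> rE; subst r.
- rewrite (_ : 21 / 256 = potential 3 4 1 (2 / (3 - 2)) / 2 :> R); first exact: low_genus.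
  by rewrite /potential /density /loss !big_ord_recr big_ord0 /=; field.
- rewrite (_ : 5 / 27 = potential 4 2 1 (2 / (4 - 2)) / 2 :> R); first exact: low_genus.
  by rewrite /potential /density /loss !big_ord_recr big_ord0 /=; field.
- rewrite (_ : 49 / 192 = potential 5 2 1 (2 / (5 - 2)) / 2 :> R); first exact: low_genus.
  by rewrite /potential /density /loss !big_ord_recr big_ord0 /=; field.
- rewrite (_ : 3 / 10 = potential 6 1 1 (2 / (6 - 2)) / 2 :> R); first exact: low_genus.
  by rewrite /potential /density /loss !big_ord_recr big_ord0 /=; field.
Qed.
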